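(* For every uncluttered graph $G$, $\chi(G)\le 2\,\omega(G)$, where $\chi(G)$ is the chromatic number of $G$ and $\omega(G)$ is the clique number of $G$ (the cardinality of its largest clique).
   Context: All graphs are finite, without loops or parallel edges. The fork is the five-vertex tree obtained from a four-vertex path by adding a vertex adjacent only to the second vertex of the path. The antifork is the complement of the fork; equivalently, it is obtained from a four-vertex path by adding one more vertex adjacent to exactly the first three vertices of the path. $G$ is uncluttered if no induced subgraph of $G$ is (isomorphic to) a fork or an antifork. A clique is a set of pairwise adjacent vertices. *)

(* Defs.v *)
From HB Require Import structures.
From mathcomp Require Import all_boot.

Set Implicit Arguments.
Unset Strict Implicit.
Unset Printing Implicit Defensive.

Record sgraph := SGraph {
  vertex :> finType;
  adj : rel vertex;
  adj_sym : symmetric adj;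
  adj_irrefl : irreflexive adj }.

Arguments adj {s} x y.

Definition isomorphic (G H : sgraph) : Prop :=
  exists2 f : G -> H, bijective f & forall x y, adj (f x) (f y) = adj x y.

Section Constructions.

Variable G : sgraph.

Definition compl_adj : rel G := fun x y => (x != y) && ~~ adj x y.

Lemma compl_adj_sym : symmetric compl_adj.
Proof. by move=> x y; rewrite /compl_adj eq_sym adj_sym. Qed.

Lemma compl_adj_irrefl : irreflexive compl_adj.
Proof. by move=> x; rewrite /compl_adj eqxx. Qed.

Definition complement : sgraph := SGraph compl_adj_sym compl_adj_irrefl.

Variable S : {set G}.

Definition induced_adj : rel {x : G | x \in S} :=
  fun x y => adj (val x) (val y).

Lemma induced_adj_sym : symmetric induced_adj.
Proof. by move=> x y; apply: adj_sym. Qed.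

Lemma induced_adj_irrefl : irreflexive induced_adj.
Proof. by move=> x; apply: adj_irrefl. Qed.

Definition induced : sgraph := SGraph induced_adj_sym induced_adj_irrefl.

End Constructions.

(* Path 0 - 1 - 2 - 3, with 4 adjacent only to 1. *)
Definition fork_edges : seq (nat * nat) :=
  [:: (0, 1); (1, 2); (2, 3); (1, 4)].

Definition fork_adj : rel 'I_5 := fun i j =>
  ((val i, val j) \in fork_edges) || ((val j, val i) \in fork_edges).

Lemma fork_adj_sym : symmetric fork_adj.
Proof. by move=> i j; apply: orbC. Qed.

Lemma fork_adj_irrefl : irreflexive fork_adj.
Proof. by case=> [[|[|[|[|[|]]]]]]. Qed.

Definition fork : sgraph := SGraph fork_adj_sym fork_adj_irrefl.

Definition antifork : sgraph := complement fork.

Definition uncluttered (G : sgraph) : Prop :=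
  forall S : {set G},
    ~ isomorphic (induced S) fork /\ ~ isomorphic (induced S) antifork.

Definition clique (G : sgraph) (K : {set G}) : bool :=
  [forall x in K, forall y in K, (x != y) ==> adj x y].

Definition clique_number (G : sgraph) : nat :=
  \max_(K : {set G} | clique K) #|K|.

Definition proper_coloring (G : sgraph) (k : nat) (c : {ffun G -> 'I_k}) :
  bool := [forall x, forall y, adj x y ==> (c x != c y)].

Definition colorable (G : sgraph) (k : nat) : bool :=
  [exists c : {ffun G -> 'I_k}, proper_coloring c].

Lemma colorable_card (G : sgraph) : exists k, colorable G k.
Proof.
exists #|G|; apply/existsP; exists [ffun x => enum_rank x].
apply/forallP=> x; apply/forallP=> y; apply/implyP=> xy; rewrite !ffunE.
by apply: contraTneq xy => /enum_rank_inj->; rewrite adj_irrefl.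
Qed.

Definition chromatic_number (G : sgraph) : nat := ex_minn (colorable_card G).

(* Main.v *)
(* In a minimal counterexample G no neighbourhood N(v) is the union of two cliques
   (otherwise deg v < 2 omega and v can be coloured last), and no non-neighbourhood
   is the union of two stable sets (otherwise colour N(v) by minimality and spend two
   new colours on the rest).  So, both in G and in its complement, every vertex v has
   three neighbours c1, c2, c3 with c1, c2 nonadjacent and c3 adjacent to both or to
   none of them: v is the centre of a claw or a vertex of degree 3 in a diamond.
   Minimality and the absence of forks and antiforks (called kites below) also imply
   that G has no nontrivial homogeneous set.  These three properties form a
   self-complementary list, and they are contradictory.  For a suitable sequence of
   small prime graphs P, ending with the four-vertex path, no copy of P is induced
   in G:
   - no vertex is complete to P, because the vertices complete to P would be complete
     to the component of the remaining graph that contains P, which would then be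
     a homogeneous set;
   - every way to add to P a claw or diamond at a well-chosen vertex of P
     has a homogeneous set that no further vertex of G can distinguish.
   Both are finite checks, which use the graphs excluded before and their complements.
   On the other hand a prime graph with two nonadjacent vertices in some N(v) contains
   a four-vertex path. *)

Require Import Defs.
From mathcomp Require Import all_boot.

Set Implicit Arguments.
Unset Strict Implicit.
Unset Printing Implicit Defensive.

(** * Induced patterns *)

(* A graph on the vertices 0, 1, 2, ... is encoded by one row per vertex other than
   vertex 0: row k is [:: adj k (k-1); ...; adj k 0].  A configuration, on the
   contrary, lists its rows from the newest vertex on and keeps the empty row of its
   oldest vertex; its vertices are numbered from the newest one. *)
Definition pattern := seq (seq bool).

Section Occurs.
Variable G : sgraph.

Fixpoint occurs (p : pattern) (ch : seq G) : Prop :=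
  if p is r :: p' then
    exists u, [/\ u \notin ch, [seq adj u x | x <- ch] = r & occurs p' (u :: ch)]
  else True.

Definition contains p := exists x, occurs p [:: x].

Fixpoint config (xs : seq G) : pattern :=
  if xs is x :: xs' then [seq adj x y | y <- xs'] :: config xs' else [::].

Definition adjm (xs : seq G) := [seq [seq adj x y | y <- xs] | x <- xs].

End Occurs.

Definition config_of (p : pattern) : pattern := rev ([::] :: p).

Definition addrow (r : seq bool) (m : seq (seq bool)) :=
  (false :: r) :: [seq q.1 :: q.2 | q <- zip r m].

Fixpoint cmat (t : pattern) : seq (seq bool) :=
  if t is r :: t' then addrow r (cmat t') else [::].

Definition entry (m : seq (seq bool)) i j := nth false (nth [::] m i) j.

(* The Boolean functions below use [if] instead of [&&] and [has] so that vm_compute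
   does not evaluate both arguments. *)
Fixpoint row_ok (row : seq bool) (i : nat) (ch : seq nat) (r : seq bool) :=
  match ch, r with
  | j :: ch', b :: r' =>
      if eqn i j then false
      else if nth false row j (+) b then false else row_ok row i ch' r'
  | [::], [::] => true
  | _, _ => false
  end.

Fixpoint has_row (f : seq bool -> nat -> bool) (i : nat) (m : seq (seq bool)) :=
  if m is row :: m' then if f row i then true else has_row f i.+1 m' else false.

Fixpoint embeds m (p : pattern) (ch : seq nat) : bool :=
  if p is r :: p' then
    has_row (fun row i => if row_ok row i ch r then embeds m p' (i :: ch) else false) 0 m
  else true.

(* Only the copies in which vertex 0 of the pattern is the newest vertex are looked
   for; this is why the patterns are supplied with all their rootings. *)
Fixpoint avoids (F : seq pattern) m :=
  if F is p :: F' then if embeds m p [:: 0] then false else avoids F' m else true.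

Lemma row_okE row i ch r :
  row_ok row i ch r = (i \notin ch) && ([seq nth false row j | j <- ch] == r).
Proof.
elim: ch r => [|j ch IH] [|b r] //=; first by rewrite andbF.
rewrite inE negb_or -[eqn i j]/(i == j) eqseq_cons IH.
by case: (i == j) => //=; case: (nth _ _ _); case: b => /=; rewrite ?andbF.
Qed.

Lemma has_rowP (f : seq bool -> nat -> bool) k m :
  reflect (exists2 i, i < size m & f (nth [::] m i) (k + i)) (has_row f k m).
Proof.
elim: m k => [|row m IH] k /=; first by constructor=> -[].
case: ifP => [h|/negP h]; first by constructor; exists 0; rewrite ?addn0.
apply: (iffP (IH k.+1)) => -[i ilt fi].
  by exists i.+1; rewrite // addnS.
case: i ilt fi => [|i] ilt fi; first by case: h; rewrite addn0 in fi.
by exists i; rewrite // addSnnS.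
Qed.

Lemma avoidsE F m : avoids F m = ~~ has (fun p => embeds m p [:: 0]) F.
Proof. by elim: F => //= p F ->; case: ifP. Qed.

(** Rows are built from the oldest vertex of [t] on, and a partial row is dropped as soon as the new
    vertex, taken as vertex 0 of a pattern in [F], completes a copy of it. This pruning keeps the
    enumeration short. *)
Fixpoint extensions F (t : pattern) : seq (seq bool) :=
  if t is _ :: t' then
    let m := cmat t in
    [seq s <- flatten [seq [:: true :: s; false :: s] | s <- extensions F t']
       | avoids F (addrow s m)]
  else [:: [::]].

Section Embedding.
Variable G : sgraph.
Implicit Types (xs ch : seq G) (p t : pattern).

Lemma adjm_cons x xs :
  adjm (x :: xs) = addrow [seq adj x y | y <- xs] (adjm xs).
Proof.
rewrite /adjm /addrow /= adj_irrefl; congr (_ :: _).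
rewrite zip_map -map_comp.
by apply: eq_map => y /=; rewrite adj_sym.
Qed.

Lemma cmat_config xs : cmat (config xs) = adjm xs.
Proof. by elim: xs => //= x xs ->; rewrite adjm_cons. Qed.

Lemma size_adjm xs : size (adjm xs) = size xs.
Proof. by rewrite size_map. Qed.

Lemma entry_adjm x0 xs i j : i < size xs -> j < size xs ->
  entry (adjm xs) i j = adj (nth x0 xs i) (nth x0 xs j).
Proof.
by move=> hi hj; rewrite /entry (nth_map x0) // (nth_map x0).
Qed.

Lemma embeds_occurs x0 xs p (ch : seq nat) :
  uniq xs -> all (fun i => i < size xs) ch -> embeds (adjm xs) p ch ->
  occurs p [seq nth x0 xs i | i <- ch].
Proof.
move=> Ux; elim: p ch => //= r p IH ch Hch /has_rowP[i].
rewrite size_adjm add0n => hi; rewrite row_okE.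
case: ifP => // /andP[/negPf ich /eqP<-] /IH; rewrite /= hi => /(_ Hch) O.
exists (nth x0 xs i); split=> //.
  apply/mapP=> -[j jch /eqP]; rewrite nth_uniq ?(allP Hch j jch) //.
  by move=> /eqP eij; rewrite eij jch in ich.
rewrite -map_comp; apply/eq_in_map => j jch /=.
by rewrite -(entry_adjm x0) ?(allP Hch j jch).
Qed.

Lemma occurs_config p ch : occurs p ch -> uniq ch ->
  exists xs, uniq xs /\ config xs = catrev p (config ch).
Proof.
elim: p ch => [|r p IH] ch /=; first by exists ch.
by case=> u [uch <- /IH H] Uch; apply: H; rewrite /= uch.
Qed.

Lemma contains_config p : contains G p ->
  exists xs, uniq xs /\ config xs = config_of p.
Proof. by case=> x /occurs_config; apply. Qed.

Lemma embeds_contains q p xs i : uniq xs -> config xs = config_of q ->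
  i < size xs -> embeds (cmat (config_of q)) p [:: i] -> contains G p.
Proof.
case: xs => // x0 xs Ux <- hi; rewrite cmat_config => H.
exists (nth x0 (x0 :: xs) i).
by apply: (@embeds_occurs x0 (x0 :: xs) p [:: i]); rewrite //= hi.
Qed.

Lemma avoids_adjm (F : seq pattern) xs : {in F, forall p, ~ contains G p} ->
  uniq xs -> 0 < size xs -> avoids F (adjm xs).
Proof.
move=> HF; case: xs => // x0 xs Ux _; rewrite avoidsE; apply/hasPn => p /HF pF; apply/negP=> H.
apply: pF; exists x0.
by apply: (@embeds_occurs x0 (x0 :: xs) p [:: 0]).
Qed.

Lemma extensions_config (F : seq pattern) xs u : {in F, forall p, ~ contains G p} ->
  uniq (u :: xs) -> [seq adj u x | x <- xs] \in extensions F (config xs).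
Proof.
move=> HF; elim: xs => [|x xs IH] U //.
have /IH {}IH : uniq (u :: xs).
  by move: U => /= /and3P[]; rewrite inE negb_or => /andP[_ ->] _ ->.
rewrite /= cmat_config mem_filter.
rewrite -adjm_cons -[adj u x :: _]/[seq adj u y | y <- x :: xs] -adjm_cons avoids_adjm //=.
apply/flattenP; exists [:: true :: [seq adj u x | x <- xs]; false :: [seq adj u x | x <- xs]].
  exact/map_f.
by rewrite !inE; case: (adj u x); rewrite eqxx.
Qed.

Lemma size_config xs : size (config xs) = size xs.
Proof. by elim: xs => //= x xs ->. Qed.

End Embedding.

Fixpoint relabel (m : seq (seq bool)) (s ch : seq nat) : pattern :=
  if s is i :: s' then [seq entry m i j | j <- ch] :: relabel m s' (i :: ch)
  else [::].

(** Each vertex in turn is listed first; [behead] removes the empty row that [relabel] gives it. The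
    filter verifies by computation that each [q] contains [p], so [rootings_contains] needs no
    reasoning about relabelling. *)
Definition rootings (p : pattern) : seq pattern :=
  let m := cmat (config_of p) in
  let idx := iota 0 (size m) in
  [seq q <- [seq behead (relabel m (i :: rem i idx) [::]) | i <- idx]
     | has (fun i => embeds (cmat (config_of q)) p [:: i]) (iota 0 (size q).+1)].

(** * Refutation of configurations *)

Definition constant_on (s r : seq bool) :=
  let l := mask s r in all id l || ~~ has id l.

Fixpoint masks n : seq (seq bool) :=
  if n is n'.+1 then flatten [seq [:: true :: s; false :: s] | s <- masks n']
  else [:: [::]].

Definition is_module (m : seq (seq bool)) (s : seq bool) :=
  [&& 1 < count id s, has negb s &
      all (fun q : bool * seq bool => q.1 || constant_on s q.2) (zip s m)].

(* In a prime graph some vertex distinguishes two elements of the module [s]; that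
   vertex is outside the configuration. *)
Definition unsplittable F (t : pattern) :=
  let m := cmat t in
  let e := extensions F t in
  has (fun s => if is_module m s then all (constant_on s) e else false)
      (masks (size t)).

(* [ch] lists, the last one first, the vertices c1, c2, c3 of a claw or diamond at v
   that have been chosen so far. *)
Definition pick (X : eqType) (R : rel X) (v : X) (ch : seq X) : bool :=
  match ch with
  | [:: c1] => R v c1
  | [:: c2; c1] => [&& R v c2, c2 != c1 & ~~ R c2 c1]
  | [:: c3; c2; c1] => [&& R v c3, c3 != c1, c3 != c2 & R c3 c1 == R c3 c2]
  | _ => false
  end.

(** The next vertex of the claw or diamond is either a vertex of [t] or a new one; a new one gets
    number 0, so [v] and the earlier choices move up by one. After the last choice an unsplittable
    module must be present. *)
Fixpoint refutes F n (t : pattern) (v : nat) (ch : seq nat) : bool :=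
  if n is n'.+1 then
    all (fun i => if pick (entry (cmat t)) v (i :: ch)
                  then refutes F n' t v (i :: ch) else true)
        (iota 0 (size t))
    && all (fun r => let ch' := 0 :: map succn ch in
                     if pick (entry (cmat (r :: t))) v.+1 ch'
                     then refutes F n' (r :: t) v.+1 ch' else true)
           (extensions F t)
  else unsplittable F t.

Definition full_row (p : pattern) := nseq (size p).+1 true.

(** The vertex u with row [r] starts an induced path u, i, j into the configuration. In
    [no_complete_vertex] this provides the edge ab for a vertex w that has a neighbour in the
    pattern. *)
Definition linked (m : seq (seq bool)) (r : seq bool) :=
  let idx := iota 0 (size m) in
  has (fun i => nth false r i &&
    has (fun j => entry m i j && ~~ nth false r j) idx) idx.

(* Every vertex that is mixed on [p] is adjacent to every vertex complete to [p]. *)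
Definition complete_spreads F (p : pattern) :=
  let t := config_of p in
  let m := cmat t in
  (0 < size p) &&
  all (fun r => if all id r || ~~ has id r then true
                else linked m r &&
                     ~~ avoids F (addrow (false :: full_row p) (addrow r m)))
      (extensions F t).

Definition prime_graph (G : sgraph) := forall A : {set G}, 1 < #|A| < #|G| ->
  exists2 u, u \notin A & exists x y, [/\ x \in A, y \in A, adj u x & ~~ adj u y].

(* c1, c2, c3 and v induce a claw with centre v or a diamond in which v and c3 have
   degree 3. *)
Definition claw_diamond (G : sgraph) (v : G) := exists c1 c2 c3 : G,
  [/\ [&& adj v c1, adj v c2 & adj v c3], c1 != c2 /\ ~~ adj c1 c2,
      c3 != c1, c3 != c2 & adj c3 c1 = adj c3 c2].

Lemma size_masks n s : s \in masks n -> size s = n.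
Proof.
elim: n s => /= [|n IH] s; first by rewrite inE => /eqP->.
by case/flattenP=> l /mapP[s' /IH E ->]; rewrite !inE => /orP[] /eqP-> /=; rewrite E.
Qed.

Section Refutation.
Variable G : sgraph.
Implicit Types (xs ch : seq G) (p t : pattern) (F : seq pattern).

Lemma rootings_contains p q : q \in rootings p -> contains G q -> contains G p.
Proof.
rewrite mem_filter => /andP[/hasP[i hi H] _] /contains_config[xs [U E]].
apply: (embeds_contains U E _ H); move: hi; rewrite mem_iota add0n.
by rewrite -(size_config xs) E size_rev.
Qed.

Lemma constant_onP s (f : G -> bool) xs x y : constant_on s [seq f z | z <- xs] ->
  x \in mask s xs -> y \in mask s xs -> f x -> f y.
Proof.
rewrite /constant_on -map_mask all_map => /orP[/allP H _ /H //|/negP H xs' _ fx].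
by case: H; rewrite has_map; apply/hasP; exists x.
Qed.

Lemma unsplittable_false F xs : {in F, forall p, ~ contains G p} -> prime_graph G ->
  uniq xs -> unsplittable F (config xs) -> False.
Proof.
move=> HF pG U /hasP[s smask]; rewrite cmat_config.
have sz := size_masks smask; rewrite size_config in sz.
case: ifP => // /and3P[c2 /hasP[b /(nthP false)[i]]].
rewrite sz => ilt {b}<- nsi /allP Hmod /allP Hext.
have [x0 _] : exists x0 : G, true by case: (xs) ilt => // x0 *; exists x0.
pose A := [set x in mask s xs].
have cA : #|A| = count id s.
  by rewrite cardsE; move/card_uniqP: (mask_uniq U s) ->; rewrite size_mask.
have /pG[u uA [x [y [xA yA ux /negP uy]]]] : 1 < #|A| < #|G|.
  rewrite cA c2 -cA -cardsT; apply/proper_card/properP; split; first exact: subsetT.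
  by exists (nth x0 xs i); rewrite ?inE // in_mask // mem_nth // index_uniq // (negPf nsi).
rewrite !inE in uA xA yA; apply: uy.
suff flt : constant_on s [seq adj u z | z <- xs] by apply: (constant_onP flt xA yA ux).
have [uxs|uxs] := boolP (u \in xs); last first.
  by apply: Hext; apply: extensions_config => //=; rewrite uxs.
have := Hmod (nth false s (index u xs), [seq adj u z | z <- xs]).
rewrite in_mask // uxs /= in uA; rewrite /= (negPf uA) /=; apply.
apply/(nthP (false, [::])); exists (index u xs).
  by rewrite size_zip size_adjm sz minnn index_mem.
rewrite nth_zip ?size_adjm // (nth_map u) ?index_mem //.
by rewrite nth_index // (negPf uA).
Qed.

Lemma pick_adjm x0 xs v c : uniq xs -> v < size xs ->
  all (fun i => i < size xs) c ->
  pick (entry (adjm xs)) v c = pick adj (nth x0 xs v) [seq nth x0 xs i | i <- c].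
Proof.
move=> U vlt; case: c => [|c1 [|c2 [|c3 []]]] //=.
- by rewrite andbT => h; rewrite (entry_adjm x0).
- by case/and3P=> h h' _; rewrite !(entry_adjm x0) // nth_uniq.
by case/and4P=> h h' h'' _; rewrite !(entry_adjm x0) // !nth_uniq.
Qed.

(** The counterpart in G of the choices that [refutes] runs through, with the same recursion. *)
Fixpoint picks n (v : G) (ch : seq G) : Prop :=
  if n is n'.+1 then exists2 c, pick adj v (c :: ch) & picks n' v (c :: ch)
  else True.

Lemma claw_diamond_picks v : claw_diamond v -> picks 3 v [::].
Proof.
case=> c1 [c2 [c3 [/and3P[v1 v2 v3] [n12 a12] n31 n32 e]]].
exists c1 => //; exists c2; first by rewrite /= v2 eq_sym n12 adj_sym.
by exists c3; rewrite //= v3 n31 n32 e eqxx.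
Qed.

Lemma refutes_false F n x0 xs v c :
  {in F, forall p, ~ contains G p} -> prime_graph G -> uniq xs -> v < size xs ->
  all (fun i => i < size xs) c -> refutes F n (config xs) v c ->
  picks n (nth x0 xs v) [seq nth x0 xs i | i <- c] -> False.
Proof.
move=> HF pG; elim: n xs v c => [|n IH] xs v c U vlt cxs.
  by move=> /= /(unsplittable_false HF pG U).
case/andP=> [/allP Hold /allP Hnew] [u uP Hn].
have [uxs|uxs] := boolP (u \in xs).
  have := Hold (index u xs); rewrite mem_iota size_config index_mem uxs => /(_ isT).
  have cxs' : all (fun i => i < size xs) (index u xs :: c) by rewrite /= index_mem uxs.
  have Ec : [seq nth x0 xs i | i <- index u xs :: c] = u :: [seq nth x0 xs i | i <- c].
    by rewrite map_cons nth_index.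
  rewrite cmat_config (pick_adjm x0) // Ec uP.
  by move/(IH _ _ _ U vlt cxs'); rewrite Ec; apply.
have U' : uniq (u :: xs) by rewrite /= uxs.
have cxs' : all (fun i => i < size (u :: xs)) (0 :: map succn c).
  by rewrite /= all_map; apply: sub_all cxs => i.
have Ec : [seq nth x0 (u :: xs) i | i <- 0 :: map succn c] = u :: [seq nth x0 xs i | i <- c].
  by rewrite /= -map_comp.
have : if pick (entry (cmat (config (u :: xs)))) v.+1 (0 :: map succn c)
       then refutes F n (config (u :: xs)) v.+1 (0 :: map succn c) else true.
  exact: Hnew (extensions_config HF U').
rewrite cmat_config (pick_adjm x0) // Ec [nth _ _ _.+1]/= uP.
by move/(IH _ v.+1 _ U' vlt cxs'); rewrite Ec; apply.
Qed.

(** Here p, x, w, r induce a diamond in which p and x have degree 3; a vertex u attached to w alone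
    would complete an antifork. *)
Definition kite_free := forall p x w r u : G,
  [&& adj p x, adj p w, adj p r, adj x w & adj x r] -> ~~ adj w r -> adj u w ->
  ~~ adj u p -> ~~ adj u r -> adj u x.

(* L n is the set of vertices at distance less than n from the copy xs of the pattern in
   the graph without X, the set of vertices complete to xs.  By induction on n, X is
   complete to L n: if w in L n has a neighbour u outside, then there are a, b in L n with
   a adjacent to w and b, and b not adjacent to w, and a vertex x of X not adjacent to u
   would give a kite on a, x, w, b, u. *)
Lemma no_complete_vertex F p : {in F, forall p, ~ contains G p} -> prime_graph G ->
  kite_free -> complete_spreads F p -> ~ contains G (rcons p (full_row p)).
Proof.
move=> HF pG kf /andP[p0 /allP Halpha] /contains_config[[|x0 xs] [U]].
  by rewrite /config_of; case: p {Halpha} p0 => //= a p _; rewrite !rev_cons; case: (rev _).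
rewrite /config_of -rcons_cons rev_rcons => -[Ex0]; rewrite -/(config_of p) => Exs.
case/andP: U => x0xs U.
have sxs : size xs = (size p).+1 by rewrite -size_config Exs size_rev.
have compl x : all (adj x) xs -> [seq adj x y | y <- xs] = full_row p.
  rewrite /full_row -sxs; elim: (xs) => //= y s IH /andP[-> /IH->] //.
have x0c : all (adj x0) xs.
  apply/allP => y yxs; have : adj x0 y \in [seq adj x0 y | y <- xs] by apply: map_f.
  by rewrite Ex0 mem_nseq => /andP[_ /eqP].
pose X := [set x | all (adj x) xs].
have compl_adjE x y : x \in X -> y \in xs -> adj x y by rewrite inE => /allP; apply.
have XN x : x \in X -> x \notin xs.
  by move=> xX; apply/negP=> /(compl_adjE _ _ xX); rewrite adj_irrefl.
have mixed u w : u \notin X -> u \notin xs -> w \in xs -> adj u w ->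
    (exists a b, [/\ a \in xs, b \in xs, adj a b, adj u a & ~~ adj u b])
    /\ (forall x, x \in X -> adj x u).
  move=> uX uxs wxs uw; have U' : uniq (u :: xs) by rewrite /= uxs.
  have := extensions_config HF U'; rewrite Exs => /Halpha; rewrite -Exs.
  rewrite all_map -[all (preim _ _) _]/(all (adj u) xs).
  rewrite inE in uX; rewrite (negPf uX) has_map.
  have -> : has (preim [eta adj u] id) xs by apply/hasP; exists w.
  rewrite /= cmat_config => /andP[/hasP[i]].
  rewrite mem_iota size_adjm add0n => /= ilt /andP[ui /hasP[j]].
  rewrite mem_iota add0n => /= jlt /andP[ij uj] Hav.
  split.
    exists (nth u xs i), (nth u xs j); rewrite !mem_nth //.
    by rewrite -(entry_adjm u) //; rewrite !(nth_map u) // in ui uj.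
  move=> x xX; apply: contraNT Hav => xu.
  have xne : x != u by apply: contraNneq uX => <-; rewrite inE in xX.
  have xux : uniq [:: x, u & xs] by rewrite /= !inE negb_or xne XN // uxs.
  have -> : false :: full_row p = [seq adj x y | y <- u :: xs].
    by rewrite /= (negPf xu) compl //; rewrite inE in xX.
  by rewrite -!adjm_cons; apply: avoids_adjm.
pose f (B : {set G}) := [set x in xs] :|: [set u in ~: X | [exists w in B, adj u w]].
have fmono : {homo f : A B / A \subset B}.
  move=> A B /subsetP AB; apply: setUS; apply/subsetP=> u; rewrite !inE.
  by case/andP=> -> /existsP[w /andP[/AB wB uw]]; apply/existsP; exists w; rewrite wB.
pose L n := iter n f set0.
have LS n : L n \subset L n.+1.
  by elim: n => [|n IH]; [exact: sub0set | exact: fmono].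
have Lmono m n : m <= n -> L m \subset L n.
  by move/subnK<-; elim: (n - m) => // k IH; rewrite addSn; apply: subset_trans IH (LS _).
have L1 n u : u \in xs -> u \in L n.+1 by move=> h; rewrite !inE h.
have LP n u : u \in L n.+1 -> u \notin xs -> u \notin X /\ exists2 w, w \in L n & adj u w.
  rewrite !inE => /orP[->//|/andP[uX /existsP[w /andP[wL uw]]] _]; split=> //.
  by exists w.
have LI n u w : w \in L n -> adj u w -> u \notin X -> u \in L n.+1.
  move=> wL uw uX; rewrite inE; apply/orP; right; rewrite inE in_setC uX.
  by apply/existsP; exists w; rewrite wL.
have level n w : w \in L n -> w \notin xs ->
    exists j, [/\ j < n, w \in L j.+1 & w \notin L j].
  move=> wL _; have ex : exists n, w \in L n by exists n.
  case: (ex_minnP ex) => -[|j]; first by rewrite inE.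
  move=> wj jmin; exists j; split=> //; first exact: jmin.
  by apply/negP=> /jmin; rewrite ltnn.
have back n w : w \in L n -> w \notin xs -> exists j a b,
    [/\ j < n, w \in L j.+1, a \in L j, b \in L j & [&& adj w a, adj a b & ~~ adj w b]].
  move=> wL wxs; have [j [jn wj wNj]] := level _ _ wL wxs.
  have [wX [a aL wa]] := LP _ _ wj wxs; exists j.
  have [axs|axs] := boolP (a \in xs).
    have [[c [d [cxs dxs cd wc wd]]] _] := mixed _ _ wX wxs axs wa.
    case: j aL {jn wj wNj} (jn) (wj) => [|j] aL; first by rewrite inE in aL.
    by move=> jn wj; exists c, d; split=> //; rewrite ?L1 // wc cd wd.
  have [i [ij ai aNi]] := level _ _ aL axs.
  have [aX [b bL ab]] := LP _ _ ai axs.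
  exists a, b; split=> //; first by apply: (subsetP (Lmono _ _ (ltnW ij))).
  rewrite wa ab /=; apply/negP=> wb; case/negP: wNj.
  by apply: (subsetP (Lmono _ _ ij)); apply: LI bL wb wX.
have complete n : forall x u, x \in X -> u \in L n -> adj x u.
  elim: n => [|n IH] x u xX; first by rewrite inE.
  move=> uL; have [uxs|uxs] := boolP (u \in xs); first exact: compl_adjE.
  have [uX [w wL uw]] := LP _ _ uL uxs.
  have [wxs|wxs] := boolP (w \in xs); first by case: (mixed _ _ uX uxs wxs uw) => _; apply.
  have [uLn|uLn] := boolP (u \in L n); first exact: IH.
  have [j [a [b [jn wj aj bj /and3P[wa ab wb]]]]] := back _ _ wL wxs.
  have sub := subsetP (Lmono _ _ (ltnW jn)).
  rewrite adj_sym; apply: (kf a x w b u) => //.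
  - by rewrite (adj_sym a x) (adj_sym a w) wa ab !IH // sub.
  - by apply: contra uLn => ua; apply: (subsetP (Lmono _ _ jn)); apply: LI aj ua uX.
  - by apply: contra uLn => ub; apply: (subsetP (Lmono _ _ jn)); apply: LI bj ub uX.
(* After [#|G|] iterations the monotone [f] has reached its fixed point D, the part of G without X
   that is reachable from xs. A vertex splitting D cannot be in X, which is complete to D, and
   otherwise its neighbour in D puts it into D. *)
pose D := L #|G|.
have fD : f D = D by exact: (@fixsetK G f fmono).
have x0D : x0 \notin D.
  by rewrite -fD !inE (negPf x0xs) x0c.
have /pG[u uD [a [b [aD bD ua /negP ub]]]] : 1 < #|D| < #|G|.
  apply/andP; split; last first.
    by rewrite -cardsT; apply/proper_card/properP; split; [exact: subsetT | exists x0].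
  have /subset_leq_card : [set x in xs] \subset D by rewrite -fD subsetUl.
  by rewrite cardsE (card_uniqP U) sxs; apply: leq_trans.
case/negP: uD; have [uX|uX] := boolP (u \in X); first by case: ub; exact: complete bD.
rewrite -fD inE; apply/orP; right; rewrite inE in_setC uX.
by apply/existsP; exists a; rewrite aD.
Qed.

End Refutation.

(** * The excluded graphs *)

Definition neg (p : pattern) : pattern := [seq [seq ~~ b | b <- r] | r <- p].

Lemma negK p : neg (neg p) = p.
Proof.
rewrite /neg -map_comp -[RHS]map_id; apply: eq_map => r /=.
by rewrite -map_comp -[RHS]map_id; apply: eq_map => b /=; rewrite negbK.
Qed.

Lemma compl_adjE (G : sgraph) (x y : G) :
  @adj (complement G) x y = (x != y) && ~~ adj x y.
Proof. by []. Qed.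

Lemma adj_neq (G : sgraph) (x y : G) : adj x y -> x != y.
Proof. by apply: contraTneq => ->; rewrite adj_irrefl. Qed.

Lemma compl_complK (G : sgraph) (x y : G) :
  @adj (complement (complement G)) x y = adj x y.
Proof. by rewrite !compl_adjE negb_and !negbK; case: eqP => //= ->; rewrite adj_irrefl. Qed.

Lemma occurs_compl (G : sgraph) p (ch : seq G) :
  @occurs (complement G) p ch <-> @occurs G (neg p) ch.
Proof.
have row (u : G) (s : seq G) : u \notin s ->
    [seq @adj (complement G) u x | x <- s] = [seq ~~ adj u x | x <- s].
  move=> us; apply/eq_in_map => x xs; rewrite /= /compl_adj.
  by case: eqP => //= ux; rewrite ux xs in us.
elim: p ch => //= r p IH ch; split=> -[u [uch E /IH O]]; exists u; split=> //.
  by rewrite -E row // -map_comp; apply: eq_map => x /=; rewrite negbK.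
by rewrite row // (map_comp negb) E -map_comp map_id_in // => b _ /=; rewrite negbK.
Qed.

Lemma contains_compl (G : sgraph) p :
  @contains (complement G) p <-> contains G (neg p).
Proof. by split=> -[x /occurs_compl]; exists x. Qed.

(** The vertices are numbered as in [fork], so [neg fork_pat] is the antifork. *)
Definition fork_pat : pattern :=
  [:: [:: true]; [:: true; false]; [:: true; false; false];
      [:: false; false; true; false]].

Definition good (G : sgraph) :=
  [/\ ~ contains G fork_pat, ~ contains G (neg fork_pat), prime_graph G,
      forall v : G, claw_diamond v &
      forall v : G, @claw_diamond (complement G) v].

Lemma good_compl G : good G -> good (complement G).
Proof.
case=> fG kG pG cG dG; split=> //.
- by move/contains_compl.
- by move/contains_compl; rewrite negK.
- move=> A /pG[u uA [x [y [xA yA ux uy]]]]; exists u => //; exists y, x.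
  by split=> //; rewrite compl_adjE ?(negPf uy) ?ux ?andbF ?andbT //; apply: contraNneq uA => ->.
move=> v; have [c1 [c2 [c3 [a [b1 b2] b3 b4 b5]]]] := cG v.
by exists c1, c2, c3; rewrite !compl_complK.
Qed.

Lemma no_kite G : ~ contains G (neg fork_pat) -> @kite_free G.
Proof.
move=> H p x w r u /and5P[px pw pr xw xr] wr uw up ur.
apply: contraT => ux; case: H.
have rw : r != w by apply: contraNneq ur => ->.
have ru : r != u by apply: contraNneq wr => ->; rewrite adj_sym.
have up' : u != p by apply: contraNneq ur => ->.
have ux' : u != x by apply: contraNneq up => ->; rewrite adj_sym.
(* In the complement, p, u, r, w is the path of the fork and x is attached to u. *)
exists p; exists u; split; first by rewrite inE.
  by rewrite /= (negPf up).
exists r; split; first by rewrite !inE negb_or ru eq_sym (adj_neq pr).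
  by rewrite /= (adj_sym r u) (negPf ur) (adj_sym r p) pr.
exists w; split.
- by rewrite !inE !negb_or (eq_sym w r) rw (eq_sym w u) (adj_neq uw) eq_sym (adj_neq pw).
- by rewrite /= (negPf wr) (adj_sym w u) uw (adj_sym w p) pw.
exists x; split=> //.
- by rewrite !inE !negb_or (adj_neq xw) (adj_neq xr) eq_sym ux' eq_sym (adj_neq px).
by rewrite /= xw xr (adj_sym x u) (negPf ux) (adj_sym x p) px.
Qed.

Definition excluded (ps : seq pattern) :=
  forall G, good G -> {in ps, forall p, ~ contains G p}.

Definition dual_rootings (ps : seq pattern) :=
  flatten [seq rootings p ++ rootings (neg p) | p <- ps].

(** As [good] is closed under complementation, excluding a pattern from all good graphs also
    excludes its complement. *)
Lemma free_rootings ps G : excluded ps -> good G ->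
  {in dual_rootings ps, forall p, ~ contains G p}.
Proof.
move=> H gG q /flattenP[s /mapP[p pps ->]]; rewrite mem_cat.
case/orP=> /rootings_contains qp /qp.
  exact: H.
by move/contains_compl; apply: H => //; apply: good_compl.
Qed.

(** The claw or diamond is placed at vertex [v] of [p], which has number [size p - v] when counted
    from the newest vertex. The first conjunct allows [p] with a complete vertex to join the
    forbidden patterns of the second. *)
Definition excludes ps p v :=
  let F := dual_rootings ps in
  complete_spreads F p &&
  refutes (F ++ rootings (rcons p (full_row p))) 3 (config_of p) (size p - v) [::].

Lemma excludedP ps p v : excluded ps -> v <= size p ->
  excludes (fork_pat :: ps) p v -> excluded (rcons ps p).
Proof.
move=> Hps vp /andP[Ha Hr] G gG q; rewrite mem_rcons inE => /orP[/eqP->{q}|]; last exact: Hps.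
have [fG kG pG cG _] := gG.
have HF : {in dual_rootings (fork_pat :: ps), forall p, ~ contains G p}.
  apply: free_rootings => // G' [f' k' p' c' d'] q'.
  by rewrite inE => /orP[/eqP-> //|]; apply: Hps.
have Hfull := no_complete_vertex HF pG (no_kite kG) Ha.
case/contains_config=> -[|x0 xs] [U E].
  by move: E => /(congr1 size); rewrite size_rev.
have sz : size (x0 :: xs) = (size p).+1 by rewrite -size_config E size_rev.
have HF' : {in dual_rootings (fork_pat :: ps) ++ rootings (rcons p (full_row p)),
    forall p, ~ contains G p}.
  by move=> q'; rewrite mem_cat => /orP[/HF//|/rootings_contains qf /qf].
have vlt : size p - v < size (x0 :: xs) by rewrite sz ltnS leq_subr.
move: Hr; rewrite -E => /(@refutes_false G _ 3 x0 _ _ [::] HF' pG U vlt isT).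
by apply; exact: (claw_diamond_picks (cG (nth x0 (x0 :: xs) (size p - v)))).
Qed.

(* Two triangles joined by two disjoint edges. *)
Definition near_prism_pat : pattern := [:: [:: true]; [:: true; false];
  [:: true; false; false]; [:: true; false; true; true]; [:: false; true; true; false; false]].
(* The bull with one of its horns lengthened by an edge. *)
Definition long_bull_pat : pattern := [:: [:: true]; [:: true; false];
  [:: true; false; false]; [:: false; false; false; true];
  [:: false; false; false; true; true]].
Definition P5_pat : pattern := [:: [:: true]; [:: true; false];
  [:: true; false; false]; [:: true; false; false; false]].
Definition C5_pat : pattern := [:: [:: true]; [:: true; false];
  [:: true; false; false]; [:: true; false; false; true]].
Definition net_pat : pattern := [:: [:: true]; [:: true; true];
  [:: false; false; true]; [:: false; false; true; false];
  [:: false; false; true; false; false]].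
Definition bull_pat : pattern := [:: [:: true]; [:: true; false];
  [:: true; false; false]; [:: false; true; true; false]].
Definition P4_pat : pattern := [:: [:: true]; [:: true; false]; [:: true; false; false]].

(* If no vertex outside N(v) distinguishes two nonadjacent vertices of N(v), then the
   vertices of N(v) with the same neighbours as c1 outside N(v) form a module. *)
Lemma prime_graph_P4 (G : sgraph) (v c1 c2 : G) : prime_graph G ->
  adj v c1 -> adj v c2 -> c1 != c2 -> ~~ adj c1 c2 -> contains G P4_pat.
Proof.
move=> pG v1 v2 n12 a12.
(* Such a triple makes b, v, a, m an induced four-vertex path. *)
pose split a b m :=
  [&& adj v a, adj v b, a != b, ~~ adj a b, ~~ adj v m, adj m a & ~~ adj m b].
have [/existsP[a /existsP[b /existsP[m]]]|none] :=
    boolP [exists a, exists b, exists m, split a b m].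
  case/and5P=> va vb nab ab /and3P[vm ma mb].
  have nvm : v != m by apply: contraNneq mb => <-.
  exists b; exists v; split; first by rewrite inE (adj_neq vb).
    by rewrite /= vb.
  exists a; split; first by rewrite !inE negb_or nab eq_sym (adj_neq va).
    by rewrite /= adj_sym va (negPf ab).
  exists m; split=> //; last by rewrite /= ma (adj_sym m v) (negPf vm) (negPf mb).
  rewrite !inE !negb_or (adj_neq ma) eq_sym nvm /=.
  by apply: contraNneq vm => ->.
have same x y m : adj v x -> adj v y -> x != y -> ~~ adj x y -> ~~ adj v m ->
    adj m x -> adj m y.
  move=> vx vy nxy xy vm mx; apply: contraNT none => my.
  apply/existsP; exists x; apply/existsP; exists y; apply/existsP; exists m.
  by rewrite /split vx vy nxy xy vm mx my.
have same' x y m : adj v x -> adj v y -> x != y -> ~~ adj x y -> ~~ adj v m ->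
    adj m x = adj m y.
  move=> vx vy nxy xy vm; apply/idP/idP; apply: same => //; by rewrite ?(eq_sym y) ?(adj_sym y).
pose R := [set x | adj v x && [forall m, ~~ adj v m ==> (adj m x == adj m c1)]].
have RP x m : x \in R -> ~~ adj v m -> adj m x = adj m c1.
  by rewrite inE => /andP[_ /forallP/(_ m)/implyP H] /H/eqP.
have R1 : c1 \in R by rewrite inE v1; apply/forallP=> m; rewrite eqxx implybT.
have R2 : c2 \in R.
  rewrite inE v2; apply/forallP=> m; apply/implyP=> vm.
  by rewrite (same' c1 c2).
have /pG[u uR [x [y [xR yR ux /negP uy]]]] : 1 < #|R| < #|G|.
  apply/andP; split.
    rewrite (cardsD1 c1) R1 ltnS card_gt0; apply/set0Pn; exists c2.
    by rewrite in_setD1 eq_sym n12.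
  rewrite -cardsT; apply/proper_card/properP; split; first exact: subsetT.
  by exists v; rewrite // inE adj_irrefl.
have [vu|vu] := boolP (adj v u); last by case: uy; rewrite (RP y) // -(RP x).
case/negP: (uR); rewrite inE vu; apply/forallP=> m; apply/implyP=> vm.
rewrite -(RP y m) // (same' u y) //; first by move: yR; rewrite inE => /andP[].
  by apply: contraNneq uR => ->.
exact/negP.
Qed.

(** This drops patterns made redundant by a smaller one: the long bull contains P5, the near prism
    contains the complement of P5, and the net contains the bull. *)
Lemma sub_excluded ps qs : {subset qs <= ps} -> excluded ps -> excluded qs.
Proof. by move=> sub H G gG q /sub; apply: H. Qed.

Lemma excluded_near_prism : excluded [:: near_prism_pat].
Proof.
have excluded0 : excluded [::] by move=> G _ p; rewrite in_nil.
apply: (@excludedP [::] near_prism_pat 1 excluded0 isT); by vm_compute.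
Qed.

Lemma excluded_long_bull : excluded [:: near_prism_pat; long_bull_pat].
Proof.
apply: (@excludedP [:: near_prism_pat] long_bull_pat 4 excluded_near_prism isT).
by vm_compute.
Qed.

Lemma excluded_P5 : excluded [:: P5_pat].
Proof.
apply: sub_excluded
  (@excludedP [:: near_prism_pat; long_bull_pat] P5_pat 2 excluded_long_bull isT _).
  by move=> p; rewrite !inE => ->; rewrite !orbT.
by vm_compute.
Qed.

Lemma excluded_C5 : excluded [:: P5_pat; C5_pat].
Proof. apply: (@excludedP [:: P5_pat] C5_pat 0 excluded_P5 isT); by vm_compute. Qed.

Lemma excluded_net : excluded [:: P5_pat; C5_pat; net_pat].
Proof. apply: (@excludedP [:: P5_pat; C5_pat] net_pat 3 excluded_C5 isT); by vm_compute. Qed.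

Lemma excluded_bull : excluded [:: P5_pat; C5_pat; bull_pat].
Proof.
apply: sub_excluded
  (@excludedP [:: P5_pat; C5_pat; net_pat] bull_pat 0 excluded_net isT _).
  by move=> p; rewrite !inE => /or3P[] ->; rewrite ?orbT.
by vm_compute.
Qed.

Lemma excluded_P4 : excluded [:: P5_pat; C5_pat; bull_pat; P4_pat].
Proof.
apply: (@excludedP [:: P5_pat; C5_pat; bull_pat] P4_pat 0 excluded_bull isT).
by vm_compute.
Qed.

Lemma good_empty (G : sgraph) (v : G) : ~ good G.
Proof.
move=> gG; have [_ _ pG cG _] := gG.
have [c1 [c2 [c3 [/and3P[v1 v2 _] [n12 a12] _ _ _]]]] := cG v.
have P4in : P4_pat \in [:: P5_pat; C5_pat; bull_pat; P4_pat] by rewrite !inE eqxx !orbT.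
exact: (excluded_P4 gG P4in (prime_graph_P4 pG v1 v2 n12 a12)).
Qed.

(** * From uncluttered graphs to patterns *)

Lemma isomorphic_induced (G H : sgraph) (zs : seq G) (h : 'I_(size zs) -> H) :
  uniq zs -> bijective h ->
  (forall i j, adj (h i) (h j) = adj (tnth (in_tuple zs) i) (tnth (in_tuple zs) j)) ->
  isomorphic (induced [set x in zs]) H.
Proof.
move=> U [h' hK h'K] Eadj.
have lt (u : induced [set x in zs]) : index (val u) zs < size zs.
  by rewrite index_mem; have := valP u; rewrite inE.
pose f u := h (Ordinal (lt u)).
have val_nth (u : induced [set x in zs]) :
    tnth (in_tuple zs) (Ordinal (lt u)) = val u.
  by rewrite (tnth_nth (val u)) /= nth_index // -index_mem lt.
exists f; last by move=> x y; rewrite Eadj !val_nth.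
have mem i : tnth (in_tuple zs) i \in [set x in zs] by rewrite inE mem_tnth.
exists (fun y => Sub (tnth (in_tuple zs) (h' y)) (mem (h' y))) => [u|y].
  by apply: val_inj; rewrite /= /f hK val_nth.
rewrite /f -[RHS]h'K; congr h; apply: val_inj => /=.
by rewrite (tnth_nth (tnth (in_tuple zs) (h' y))) index_uniq.
Qed.

Lemma uncluttered_contains G : uncluttered G ->
  ~ contains G fork_pat /\ ~ contains G (neg fork_pat).
Proof.
(* Reversing both rows and columns turns the newest-first matrix into the numbering used by
   [fork]. *)
have H0 (e : rel 'I_5) (s : symmetric e) (i : irreflexive e) p : size p = 4 ->
    (forall a b : 'I_5, e a b = entry (rev [seq rev r | r <- cmat (config_of p)]) a b) ->
    contains G p -> exists S : {set G}, isomorphic (induced S) (SGraph s i).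
  move=> sp He /contains_config[xs [U E]].
  have sz : size (rev xs) = 5 by rewrite size_rev -size_config E size_rev /= sp.
  exists [set x in rev xs]; apply: (@isomorphic_induced _ (SGraph s i) _ (cast_ord sz)).
  - by rewrite rev_uniq.
  - by exists (cast_ord (esym sz)); [exact: cast_ordK | exact: cast_ordKV].
  have revE : rev [seq rev r | r <- adjm xs] = adjm (rev xs).
    rewrite /adjm map_rev -map_comp; congr rev; apply: eq_map => x /=.
    by rewrite map_rev.
  move=> a b; pose x0 := tnth (in_tuple (rev xs)) a.
  rewrite {1}/adj /= He -E cmat_config revE /= (entry_adjm x0 (ltn_ord a) (ltn_ord b)).
  by rewrite !(tnth_nth x0).
move=> unc; split=> [/H0 H|/H0 H].
  have [|S] := H _ fork_adj_sym fork_adj_irrefl erefl; last by have [] := unc S.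
  by case=> -[|[|[|[|[|]]]]] // ?; case=> -[|[|[|[|[|]]]]] // ?.
have [|S] := H _ (@compl_adj_sym fork) (@compl_adj_irrefl fork) erefl; last by have [] := unc S.
by case=> -[|[|[|[|[|]]]]] // ?; case=> -[|[|[|[|[|]]]]] // ?.
Qed.

(** The path of the fork is a, c, d, f, and b hangs on c. Apart from [a != b], all inequalities
    follow from the adjacencies. *)
Lemma no_fork (G : sgraph) (c a b d f : G) : ~ contains G fork_pat ->
  adj c a -> adj c b -> adj c d -> adj d f -> a != b -> ~~ adj a b ->
  ~~ adj a d -> ~~ adj b d -> ~~ adj f c -> ~~ adj f a -> ~~ adj f b -> False.
Proof.
move=> H ca cb cd df nab ab ad bd fc fa fb; apply: H.
have da : d != a by apply: contraNneq fa => <-; rewrite adj_sym.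
have db : d != b by apply: contraNneq fb => <-; rewrite adj_sym.
have nfa : f != a by apply: contraNneq ad => <-; rewrite adj_sym.
have nfb : f != b by apply: contraNneq bd => <-; rewrite adj_sym.
have nfc : f != c by apply: contraNneq fa => ->.
exists a; exists c; split; first by rewrite inE (adj_neq ca).
  by rewrite /= ca.
exists d; split; first by rewrite !inE negb_or eq_sym (adj_neq cd).
  by rewrite /= adj_sym cd adj_sym (negPf ad).
exists f; split.
- by rewrite !inE !negb_or nfa nfc eq_sym (adj_neq df).
- by rewrite /= adj_sym df (negPf fc) (negPf fa).
exists b; split=> //.
- by rewrite !inE !negb_or eq_sym nfb eq_sym db eq_sym (adj_neq cb) eq_sym nab.
by rewrite /= (adj_sym b f) (negPf fb) (negPf bd) (adj_sym b c) cb (adj_sym b a) (negPf ab).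
Qed.

(** * Colourings and cliques *)

Section Colouring.
Variable G : sgraph.
Implicit Types (S A B K : {set G}) (k : nat).

(** With total functions into [nat], colourings of different vertex sets can be glued and shifted
    freely. *)
Definition colours S k := exists f : G -> nat,
  {in S, forall x, f x < k} /\ {in S &, forall x y, adj x y -> f x != f y}.

Definition omega S := \max_(K : {set G} | clique K && (K \subset S)) #|K|.

Lemma cliqueP K :
  reflect {in K &, forall x y, x != y -> adj x y} (clique K).
Proof.
apply: (iffP forall_inP) => [H x y xK yK nxy|H x xK].
  by have /forall_inP/(_ y yK)/implyP := H x xK; apply.
by apply/forall_inP => y yK; apply/implyP; apply: H.
Qed.

Lemma clique_omega K S : clique K -> K \subset S -> #|K| <= omega S.
Proof. by move=> cK KS; apply: (leq_bigmax_cond K); rewrite cK. Qed.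

Lemma omega_clique S : exists2 K, clique K && (K \subset S) & #|K| = omega S.
Proof.
have c0 : clique (set0 : {set G}) && (set0 \subset S).
  by rewrite sub0set andbT; apply/cliqueP => x; rewrite inE.
have [K KP E] :=
  @eq_bigmax_cond _ [pred K : {set G} | clique K && (K \subset S)] (fun K => #|K|)
  (ltac:(by apply/card_gt0P; exists set0)).
by exists K.
Qed.

Lemma omega_mono S S' : S \subset S' -> omega S <= omega S'.
Proof.
move=> SS; have [K /andP[cK KS] <-] := omega_clique S.
exact: clique_omega (subset_trans KS SS).
Qed.

Lemma clique_setU K K' : clique K -> clique K' ->
  {in K & K', forall x y, x != y -> adj x y} -> clique (K :|: K').
Proof.
move=> /cliqueP cK /cliqueP cK' KK'; apply/cliqueP => x y.
rewrite !inE => /orP[xK|xK] /orP[yK|yK] nxy; [exact: cK|exact: KK'| |exact: cK'].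
by rewrite adj_sym KK' // eq_sym.
Qed.

Lemma clique1 (v : G) : clique [set v].
Proof. by apply/cliqueP => x y /set1P-> /set1P->; rewrite eqxx. Qed.

Lemma omega_complete A B : {in A & B, forall x y, adj x y} ->
  omega A + omega B <= omega setT.
Proof.
move=> AB; have [K /andP[cK /subsetP KA] <-] := omega_clique A.
have [K' /andP[cK' /subsetP KB] <-] := omega_clique B.
have disj : [disjoint K & K'].
  rewrite -setI_eq0; apply: contraT => /set0Pn[x /setIP[/KA xA /KB xB]].
  by have := AB x x xA xB; rewrite adj_irrefl.
have /eqP<- : #|K :|: K'| == #|K| + #|K'| by rewrite (leq_card_setU K K').2.
apply: clique_omega (subsetT _); apply: clique_setU => // x y /KA xA /KB yB _.
exact: AB.
Qed.

Lemma colorableP k : colorable G k <-> colours setT k.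
Proof.
split=> [/existsP[c /forallP cP]|[f [fS fP]]].
  exists (fun x => nat_of_ord (c x)); split=> // x y _ _ xy.
  by have /forallP/(_ y)/implyP := cP x; apply.
apply/existsP; exists [ffun x => Ordinal (fS x (in_setT x))].
apply/forallP => x; apply/forallP => y; apply/implyP => xy; rewrite !ffunE.
by have := fP x y (in_setT x) (in_setT y) xy.
Qed.

Lemma chromatic_number_le k : colours setT k -> chromatic_number G <= k.
Proof.
by move=> /colorableP H; rewrite /chromatic_number; case: ex_minnP => m _; apply.
Qed.

Lemma clique_numberE : clique_number G = omega setT.
Proof. by apply: eq_bigl => K; rewrite subsetT andbT. Qed.

(** Fix a neighbour c of v and separate the neighbours that are c or adjacent to c from the others.
    Two nonadjacent vertices on the same side, both different from c, would form a claw or diamond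
    with v and c. *)
Lemma two_cliques (v : G) : claw_diamond v \/ exists A B,
  [/\ clique A, clique B & [set x | adj v x] = A :|: B].
Proof.
have [/existsP[c1 /existsP[c2 /existsP[c3 /and5P[h1 h2 h3 h4 /andP[h5 /eqP h6]]]]]|none] :=
    boolP [exists c1, exists c2, exists c3,
      [&& [&& adj v c1, adj v c2 & adj v c3], c1 != c2, ~~ adj c1 c2, c3 != c1,
          c3 != c2 & adj c3 c1 == adj c3 c2]].
  by left; exists c1, c2, c3.
have {}none c1 c2 c3 : adj v c1 -> adj v c2 -> adj v c3 -> c1 != c2 -> c3 != c1 ->
    c3 != c2 -> adj c3 c1 = adj c3 c2 -> adj c1 c2.
  move=> v1 v2 v3 n12 n31 n32 e; apply: contraNT none => a12.
  apply/existsP; exists c1; apply/existsP; exists c2; apply/existsP; exists c3.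
  by rewrite v1 v2 v3 n12 a12 n31 n32 e eqxx.
right; have [c vc|empty] := pickP (adj v); last first.
  exists set0, set0; split; try by apply/cliqueP => x; rewrite inE.
  by apply/setP => x; rewrite !inE empty.
exists [set x | adj v x & (x == c) || adj c x], [set x | adj v x & (x != c) && ~~ adj c x].
split.
- apply/cliqueP => x y; rewrite !inE => /andP[vx xc] /andP[vy yc] nxy.
  have [xE|nxc] := eqVneq x c; first by move: yc nxy; rewrite xE eq_sym => /orP[->|].
  have [yE|nyc] := eqVneq y c; first by move: xc; rewrite (negPf nxc) yE adj_sym.
  rewrite (negPf nxc) (negPf nyc) /= in xc yc.
  by apply: (none x y c) => //; rewrite 1?eq_sym // xc yc.
- apply/cliqueP => x y; rewrite !inE => /and3P[vx nxc xc] /and3P[vy nyc yc] nxy.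
  by apply: (none x y c) => //; rewrite 1?eq_sym // (negPf xc) (negPf yc).
by apply/setP => x; rewrite !inE; case: (adj v x) => //=; case: (x == c); case: (adj c x).
Qed.

End Colouring.

(** * Minimal counterexamples *)

Section Minimal.
Variable G : sgraph.
Implicit Types (S A B K : {set G}) (k : nat).
Hypothesis no_fork_G : ~ contains G fork_pat.
Hypothesis no_kite_G : ~ contains G (neg fork_pat).
Hypothesis sub_colours : forall S, S != setT -> colours S (2 * omega S).
Hypothesis not_colours : ~ colours [set: G] (2 * omega [set: G]).

Lemma colours_proper S v : v \notin S -> colours S (2 * omega S).
Proof.
by move=> vS; apply: sub_colours; apply: contraNneq vS => ->; rewrite inE.
Qed.

Lemma clique_nbrs (v : G) A : clique A -> {in A, forall x, adj v x} ->
  #|A| < omega [set: G].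
Proof.
move=> cA vA; have vnA : v \notin A by apply/negP=> /vA; rewrite adj_irrefl.
have <- : #|v |: A| = #|A|.+1 by rewrite cardsU1 vnA.
apply: clique_omega (subsetT _); apply: clique_setU => //; first exact: clique1.
by move=> x y /set1P-> /vA.
Qed.

Lemma minimal_degree (v : G) : 2 * omega [set: G] <= #|[set x | adj v x]|.
Proof.
rewrite leqNgt; apply/negP=> deg; apply: not_colours.
have [f [fS fP]] : colours (~: [set v]) (2 * omega (~: [set v])).
  by apply: (@colours_proper _ v); rewrite !inE eqxx.
pose used := [seq f x | x <- enum [set x | adj v x]].
have [c clt cfree] : exists2 c, c < 2 * omega [set: G] & c \notin used.
  have [/allP all_used|/allPn[c]] := boolP (all (mem used) (iota 0 (2 * omega [set: G]))).
    have := uniq_leq_size (iota_uniq _ _) all_used.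
    by rewrite size_iota size_map -cardE leqNgt deg.
  by rewrite mem_iota add0n; exists c.
have free x : adj v x -> c != f x.
  by move=> vx; apply: contraNneq cfree => ->; apply: map_f; rewrite mem_enum inE.
exists (fun x => if x == v then c else f x); split=> [x _|x y _ _ xy].
  case: eqVneq => // xv; apply: leq_trans (fS x _) _; first by rewrite !inE.
  by rewrite leq_mul2l omega_mono ?subsetT.
have [xv|xv] := eqVneq x v; have [yv|yv] := eqVneq y v.
- by rewrite xv yv adj_irrefl in xy.
- by apply: free; rewrite -xv.
- by rewrite eq_sym; apply: free; rewrite -yv adj_sym.
by apply: fP; rewrite ?inE.
Qed.

Lemma minimal_claw_diamond (v : G) : claw_diamond v.
Proof.
have [//|[A [B [cA cB E]]]] := two_cliques v.
have /clique_nbrs HA : {in A, forall x, adj v x}.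
  by move=> x xA; have : x \in A :|: B by [rewrite inE xA]; rewrite -E inE.
have /clique_nbrs HB : {in B, forall x, adj v x}.
  by move=> x xB; have : x \in A :|: B by [rewrite inE xB orbT]; rewrite -E inE.
have := minimal_degree v; rewrite E leqNgt; case/negP.
apply: leq_ltn_trans (leq_card_setU A B).1 _.
by rewrite mul2n -addnn -addnS leq_add ?HB // ltnW ?HA.
Qed.

Lemma minimal_not_nbrs_clique (v : G) : ~ clique [set x | adj v x].
Proof.
move=> c; have := minimal_degree v; rewrite leqNgt; case/negP.
have /(clique_nbrs c) : {in [set x | adj v x], forall x, adj v x} by move=> x; rewrite inE.
by move=> h; apply: leq_trans h _; rewrite leq_pmull.
Qed.

Lemma minimal_compl_claw_diamond (v : G) : @claw_diamond (complement G) v.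
Proof.
have [//|[A [B [/cliqueP cA /cliqueP cB E]]]] := @two_cliques (complement G) v.
pose N := [set x : G | adj v x]; pose w := omega [set: G].
have vN : v \notin N by rewrite inE adj_irrefl.
have [f [fS fP]] := colours_proper vN.
have Nw : omega N < w.
  have [K /andP[cK /subsetP KN] <-] := omega_clique N.
  by apply: (@clique_nbrs v K cK) => x /KN; rewrite inE.
have mem x : x \notin N -> x != v -> (x \in A) || (x \in B).
  rewrite inE => vx xv; have : x \in A :|: B; last by rewrite inE.
  by rewrite -E inE compl_adjE eq_sym xv vx.
case: not_colours.
(* A and B are stable in G. The vertex v lies in neither and shares the last colour with B; all its
   neighbours are in N. *)
exists (fun x => if x \in N then f x else if x \in A then 2 * omega N else (2 * omega N).+1).
split=> [x _|].
  have h : (2 * omega N).+1 < 2 * w.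
    by apply: leq_trans (_ : 2 * (omega N).+1 <= _); rewrite ?leq_mul2l ?Nw ?orbT // mulnS.
  case: ifP => [/fS xl|_]; first by apply: ltn_trans xl (ltn_trans _ h).
  by case: ifP => _ //; apply: ltn_trans h.
have key x y : x \notin N -> y \notin N -> adj x y -> (x \in A) != (y \in A).
  move=> xN yN xy; have nxy := adj_neq xy.
  have [xv|xv] := eqVneq x v; first by move: yN; rewrite inE -xv xy.
  have [yv|yv] := eqVneq y v; first by move: xN; rewrite inE -yv adj_sym xy.
  apply/negP=> /eqP same; have := mem x xN xv; have := mem y yN yv.
  rewrite same; case yA : (y \in A) same => xA /=; last first.
    by move=> yB xB; have := cB x y xB yB nxy; rewrite compl_adjE xy andbF.
  by have := cA x y xA yA nxy; rewrite compl_adjE xy andbF.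
move=> x y _ _ xy.
have [xN|xN] := boolP (x \in N); have [yN|yN] := boolP (y \in N).
- exact: fP.
- by have := fS x xN; case: ifP => _ h; rewrite ltn_eqF // ltnW.
- by have := fS y yN; case: ifP => _ h; rewrite gtn_eqF // ltnW.
have := key x y xN yN xy.
by do 2!case: ifP => //= _; rewrite ?(ltn_eqF (ltnSn _)) ?(gtn_eqF (ltnSn _)).
Qed.

(** Otherwise N(u) is contained in N(v), and a colouring of G without u extends by giving u the
    colour of v. *)
Lemma minimal_incomparable (u v : G) : u != v -> ~~ adj u v ->
  exists2 x, adj u x & ~~ adj v x.
Proof.
move=> nuv auv; apply/exists_inP; apply: contraT => none; case: not_colours.
have sub x : adj u x -> adj v x.
  by move=> ux; apply: contraNT none => vx; apply/exists_inP; exists x.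
have [f [fS fP]] : colours (~: [set u]) (2 * omega (~: [set u])).
  by apply: (@colours_proper _ u); rewrite !inE eqxx.
have v_in : v \in ~: [set u] by rewrite !inE eq_sym.
have le : 2 * omega (~: [set u]) <= 2 * omega [set: G] by rewrite leq_mul2l omega_mono ?subsetT.
exists (fun x => if x == u then f v else f x); split=> [x _|x y _ _ xy].
  by case: eqVneq => xu; apply: leq_trans (fS _ _) le; rewrite // !inE.
have [xu|xu] := eqVneq x u; have [yu|yu] := eqVneq y u.
- by rewrite xu yu adj_irrefl in xy.
- by apply: fP => //; [rewrite !inE | apply: sub; rewrite -xu].
- by apply: fP => //; [rewrite !inE | rewrite adj_sym; apply: sub; rewrite -yu adj_sym].
by apply: fP; rewrite ?inE.
Qed.

Lemma minimal_twins (u v : G) : u != v -> ~~ adj u v -> ~ (forall x, adj u x = adj v x).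
Proof.
by move=> nuv auv H; have [x ux] := minimal_incomparable nuv auv; rewrite -H ux.
Qed.

Lemma minimal_connected A (a b : G) : a \in A -> b \notin A ->
  exists x y, [/\ x \in A, y \notin A & adj x y].
Proof.
move=> aA bA; have [/exists_inP[x xA /exists_inP[y yA xy]]|none] :=
  boolP [exists x in A, exists y in ~: A, adj x y].
  by exists x, y; rewrite inE in yA.
case: not_colours.
have {}none x y : x \in A -> y \notin A -> adj x y = false.
  move=> xA yA; apply: contraNF none => xy; apply/exists_inP; exists x => //.
  by apply/exists_inP; exists y; rewrite ?inE.
have [f [fS fP]] := colours_proper bA.
have [|g [gS gP]] := @colours_proper (~: A) a; first by rewrite inE aA.
exists (fun x => if x \in A then f x else g x); split=> [x _|x y _ _ xy].
  case: ifP => [/fS|/negbT xA]; last have := gS x; rewrite ?inE => h.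
    by apply: leq_trans h _; rewrite leq_mul2l omega_mono ?subsetT.
  by apply: leq_trans (h xA) _; rewrite leq_mul2l omega_mono ?subsetT.
have [xA|xA] := boolP (x \in A); have [yA|yA] := boolP (y \in A).
- exact: fP.
- by rewrite none in xy.
- by rewrite adj_sym none in xy.
by apply: gP; rewrite ?inE.
Qed.

(** If A were complete to the rest, the clique numbers of the two sides would add up to at most that
    of G, so disjoint sets of colours would suffice. *)
Lemma minimal_coconnected A (a b : G) : a \in A -> b \notin A ->
  exists x y, [/\ x \in A, y \notin A & ~~ adj x y].
Proof.
move=> aA bA; have [/exists_inP[x xA /exists_inP[y yA xy]]|none] :=
  boolP [exists x in A, exists y in ~: A, ~~ adj x y].
  by exists x, y; rewrite inE in yA.
case: not_colours.
have {}none : {in A & ~: A, forall x y, adj x y}.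
  move=> x y xA yA; apply: contraNT none => xy; apply/exists_inP; exists x => //.
  by apply/exists_inP; exists y.
have [f [fS fP]] := colours_proper bA.
have [|g [gS gP]] := @colours_proper (~: A) a; first by rewrite inE aA.
have le := omega_complete none.
exists (fun x => if x \in A then f x else 2 * omega A + g x); split=> [x _|x y _ _ xy].
  have {}le : 2 * omega A + 2 * omega (~: A) <= 2 * omega [set: G].
    by rewrite -mulnDr leq_mul2l le.
  case: ifP => [/fS|/negbT xA]; last have := gS x; rewrite ?inE => h.
    by apply: leq_trans h (leq_trans (leq_addr _ _) le).
  by apply: leq_trans le; rewrite ltn_add2l h.
have [xA|xA] := boolP (x \in A); have [yA|yA] := boolP (y \in A).
- exact: fP.
- by rewrite ltn_eqF //; apply: leq_trans (fS x xA) (leq_addr _ _).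
- by rewrite gtn_eqF //; apply: leq_trans (fS y yA) (leq_addr _ _).
by rewrite eqn_add2l; apply: gP; rewrite ?inE.
Qed.

(** * Homogeneous sets in a minimal counterexample *)

Definition homogeneous (Z : {set G}) :=
  forall u x y, u \notin Z -> x \in Z -> y \in Z -> adj u x = adj u y.

Lemma minimal_stable_module Z (a b : G) : homogeneous Z -> a \in Z -> b \in Z ->
  a != b -> ~ {in Z &, forall x y, ~~ adj x y}.
Proof.
move=> hZ aZ bZ nab st; apply: (minimal_twins nab (st a b aZ bZ)) => t.
have [tZ|tZ] := boolP (t \in Z); first by rewrite !(negPf (st _ _ _ _)).
by rewrite adj_sym (hZ t a b) // adj_sym.
Qed.

(* A homogeneous set Z with both an edge and a nonedge.  X and Y are the vertices
   complete and anticomplete to Z.  A vertex y0 of Y with the fewest neighbours in X has a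
   clique as its neighbourhood, unless G or its complement is disconnected or G has
   nonadjacent twins. *)
Section MixedModule.
Variables (Z : {set G}) (z1 z2 z3 z4 b : G).
Hypotheses (hZ : homogeneous Z) (bZ : b \notin Z).
Hypotheses (z1Z : z1 \in Z) (z2Z : z2 \in Z) (z12 : adj z1 z2).
Hypotheses (z3Z : z3 \in Z) (z4Z : z4 \in Z) (nz34 : z3 != z4) (z34 : ~~ adj z3 z4).

Let X := [set x | x \notin Z & adj x z1].
Let Y := [set y | y \notin Z & ~~ adj y z1].

Let XZ x z : x \in X -> z \in Z -> adj x z.
Proof. by rewrite inE => /andP[xZ xz1] zZ; rewrite (hZ xZ zZ z1Z). Qed.

Let YZ y z : y \in Y -> z \in Z -> ~~ adj y z.
Proof. by rewrite inE => /andP[yZ yz1] zZ; rewrite (hZ yZ zZ z1Z). Qed.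

Let cases t : [\/ t \in Z, t \in X | t \in Y].
Proof.
have [tZ|tZ] := boolP (t \in Z); first by constructor 1.
by have [t1|t1] := boolP (adj t z1); [constructor 2 | constructor 3]; rewrite inE tZ.
Qed.

(** The nonedge of Z turns a failure into a fork centred at x. In [Y_nonedge] the edge of Z plays
    the dual role and gives a kite. *)
Let X_edge x y y' : x \in X -> y \in Y -> y' \in Y -> adj x y -> adj y y' -> adj x y'.
Proof.
move=> xX yY y'Y xy yy'; apply: contraT => xy'.
case: (no_fork no_fork_G (c := x) (a := z3) (b := z4) (d := y) (f := y')) => //.
- exact: XZ.
- exact: XZ.
- by rewrite adj_sym YZ.
- by rewrite adj_sym YZ.
- by rewrite adj_sym.
- exact: YZ.
- exact: YZ.
Qed.

Let Y_nonedge x x' y : x \in X -> x' \in X -> y \in Y -> x != x' -> ~~ adj x x' ->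
  adj x y = adj x' y.
Proof.
have half s s' : s \in X -> s' \in X -> y \in Y -> ~~ adj s s' -> adj s y -> adj s' y.
  move=> sX s'X yY ss' sy; apply: contraT => s'y.
  have := no_kite no_kite_G (p := z1) (x := z2) (w := s) (r := s') (u := y).
  rewrite (negPf (YZ yY z2Z)) => H; apply: H => //.
  - by rewrite z12 (adj_sym z1 s) (adj_sym z1 s') (adj_sym z2 s) (adj_sym z2 s') !XZ.
  - by rewrite adj_sym.
  - exact: YZ.
  - by rewrite adj_sym.
move=> xX x'X yY nxx xx'; apply/idP/idP; first exact: half.
by apply: half; rewrite // adj_sym.
Qed.

Let NX y := [set x in X | adj x y].

Let NX_edge y y' : y \in Y -> y' \in Y -> adj y y' -> NX y = NX y'.
Proof.
move=> yY y'Y yy'; apply/setP => x; rewrite !inE.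
case xX : ((x \notin Z) && adj x z1) => //=.
have {}xX : x \in X by rewrite inE.
by apply/idP/idP => h; [apply: X_edge h yy' | apply: X_edge h _; rewrite // adj_sym].
Qed.

Lemma minimal_mixed_module : False.
Proof.
have [z [yy [zZ yyZ zyy]]] := minimal_coconnected z1Z bZ.
have yyY : yy \in Y.
  by have [/idPn[] //|/XZ/(_ zZ)|//] := cases yy; rewrite adj_sym (negPf zyy).
have z1X : z1 \notin X by rewrite inE z1Z.
have z1Y : z1 \notin Y by rewrite inE z1Z.
pose y0 := [arg min_(y < yy in Y) #|NX y|]; pose X1 := NX y0.
have [y0Y y0min] : y0 \in Y /\ forall y, y \in Y -> NX y \subset X1 -> NX y = X1.
  rewrite /X1 /y0; case: arg_minnP => // y yY ymin; split=> // y' y'Y sub.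
  by apply/eqP; rewrite eqEcard sub ymin.
have X1X x : x \in X1 -> x \in X by rewrite inE => /andP[].
have X1X0 x x' : x \in X1 -> x' \in X -> x' \notin X1 -> adj x x'.
  move=> x1 x'X x'1; apply: contraT => xx'.
  have nxx : x != x' by apply: contraNneq x'1 => <-.
  have := Y_nonedge (X1X x x1) x'X y0Y nxx xx'.
  have xy0 : adj x y0 by move: x1; rewrite inE => /andP[].
  by rewrite xy0 => E; case/negP: x'1; rewrite inE x'X -E.
have outside y : y \in Y -> X1 \subset NX y \/ exists2 x, x \in NX y & x \notin X1.
  move=> yY; have [/(y0min _ yY) ->|/subsetPn[x]] := boolP (NX y \subset X1).
    by left.
  by right; exists x.
pose D := [set y in Y | NX y == X1].
have DP y : y \in D -> y \in Y /\ NX y = X1 by rewrite inE => /andP[? /eqP].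
have D_clique y y' : y \in D -> y' \in D -> y != y' -> adj y y'.
  move=> /DP[yY Ny] /DP[y'Y Ny'] nyy; apply: contraT => yy'.
  (* A nonedge in D forces X1 to be complete to Y, hence to everything outside X1. This contradicts
     coconnectedness unless X1 is empty, and then no edge leaves D. *)
  have full x q : x \in X1 -> q \in Y -> adj x q.
    move=> x1 qY; have [/subsetP/(_ x x1)|[x' x'q x'1]] := outside q qY.
      by rewrite inE => /andP[].
    apply: contraT => xq.
    have [x'X x'q'] : x' \in X /\ adj x' q by move: x'q; rewrite inE => /andP[].
    have x'y : ~~ adj x' y by move: x'1; rewrite -Ny inE x'X.
    have x'y' : ~~ adj x' y' by move: x'1; rewrite -Ny' inE x'X.
    have xy : adj x y by move: x1; rewrite -Ny inE => /andP[].
    have xy1 : adj x y' by move: x1; rewrite -Ny' inE => /andP[].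
    case: (no_fork no_fork_G (c := x) (a := y) (b := y') (d := x') (f := q)) => //.
    - exact: X1X0.
    - by rewrite adj_sym.
    - by rewrite adj_sym.
    - by rewrite adj_sym.
    - by apply: contra x'y; apply: X_edge.
    - by apply: contra x'y'; apply: X_edge.
  have [X1e|[x1 x1X1]] := set_0Vmem X1.
    have y0D : y0 \in D by rewrite inE y0Y eqxx.
    have z1D : z1 \notin D by rewrite inE (negPf z1Y).
    have [p [q [pD qD pq]]] := minimal_connected y0D z1D.
    have [pY Np] := DP p pD.
    have [qZ|qX|qY] := cases q.
    - by rewrite (negPf (YZ pY qZ)) in pq.
    - by have : q \in NX p; [rewrite inE qX adj_sym | rewrite Np X1e inE].
    - by case/negP: qD; rewrite inE qY -(NX_edge pY qY pq) Np eqxx.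
  have z1X1 : z1 \notin X1 by apply: contra z1X => /X1X.
  have [p [q [pX1 qX1 pq]]] := minimal_coconnected x1X1 z1X1.
  case/negP: pq; have [qZ|qX|qY] := cases q.
  - exact: XZ (X1X _ pX1) qZ.
  - exact: X1X0.
  - exact: full.
have X1_clique x1 x2 : x1 \in X1 -> x2 \in X1 -> x1 != x2 -> adj x1 x2.
  move=> x1X1 x2X1 nx12; apply: contraT => x12.
  have [x1X x2X] := (X1X x1 x1X1, X1X x2 x2X1).
  (* E is complete to the rest of X by [Y_nonedge]. If E has an edge, the absence of kites makes it
     complete to Y too, against coconnectedness; if E is stable, x1 and x2 are nonadjacent twins. *)
  pose E := [set x in X | [forall y in Y, adj x y == adj x1 y]].
  have EP x y : x \in E -> y \in Y -> adj x y = adj x1 y.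
    by rewrite inE => /andP[_ /forall_inP H] /H/eqP.
  have EX x : x \in E -> x \in X by rewrite inE => /andP[].
  have x1E : x1 \in E by rewrite inE x1X; apply/forall_inP => y.
  have E_closed x x' : x \in E -> x' \in X -> x' \notin E -> adj x x'.
    move=> xE x'X x'E; apply: contraT => xx'; case/negP: (x'E).
    rewrite inE x'X; apply/forall_inP => y yY; rewrite -(EP x y xE yY).
    apply/eqP/esym/Y_nonedge => //; first exact: EX.
    by apply: contraNneq x'E => <-.
  have x2E : x2 \in E by apply: contraT => /(E_closed x1 x2 x1E x2X); rewrite (negPf x12).
  have EX1 x : x \in E -> x \in X1.
    move=> xE; rewrite inE EX // (EP x y0) //; by move: x1X1; rewrite inE => /andP[].
  have [/exists_inP[x3 x3E /exists_inP[x4 x4E x34]]|none] :=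
      boolP [exists x in E, exists x' in E, adj x x'].
    have full y : y \in Y -> adj x1 y.
      move=> yY; have [/subsetP/(_ x1 x1X1)|[x' x'y x'1]] := outside y yY.
        by rewrite inE => /andP[].
      have [x'X x'y'] : x' \in X /\ adj x' y by move: x'y; rewrite inE => /andP[].
      have x'y0 : ~~ adj x' y0 by move: x'1; rewrite inE x'X.
      apply: contraT => x1y.
      have Ey0 x : x \in E -> adj x y0 by move/EX1; rewrite inE => /andP[].
      have := no_kite no_kite_G (p := x3) (x := x4) (w := x') (r := y0) (u := y).
      rewrite (adj_sym y x3) (adj_sym y x4) (EP x3 y) // (EP x4 y) // (negPf x1y).
      move=> H; apply: H => //.
      - by rewrite x34 !Ey0 // !X1X0 // EX1.
      - by rewrite adj_sym.
      - by apply: contra x'y0; apply: X_edge.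
    have z1E : z1 \notin E by apply: contra z1X => /EX.
    have [p [q [pE qE pq]]] := minimal_coconnected x1E z1E.
    case/negP: pq; have [qZ|qX|qY] := cases q; [exact: XZ (EX _ pE) qZ|exact: E_closed|].
    by rewrite EP // full.
  have EE x x' : x \in E -> x' \in E -> adj x x' = false.
    move=> xE x'E; apply: contraNF none => xx'; apply/exists_inP; exists x => //.
    by apply/exists_inP; exists x'.
  case: (minimal_twins nx12 x12) => t; have [tZ|tX|tY] := cases t.
  - by rewrite !XZ.
  - have [tE|tE] := boolP (t \in E); first by rewrite !EE.
    by rewrite !E_closed.
  - by rewrite (EP x2).
(* All neighbours of y0 lie in X1 or D, two cliques that are complete to each other. *)
case: (@minimal_not_nbrs_clique y0); apply/cliqueP => p q.
rewrite [p \in _]inE [q \in _]inE => y0p y0q npq.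
have side t : adj y0 t -> t \in X1 \/ t \in D.
  move=> y0t; have [tZ|tX|tY] := cases t.
  - by rewrite (negPf (YZ y0Y tZ)) in y0t.
  - by left; rewrite inE tX adj_sym.
  - by right; rewrite inE tY -(NX_edge y0Y tY y0t) eqxx.
have X1D x y : x \in X1 -> y \in D -> adj x y.
  by move=> xX1 /DP[_ Ny]; move: xX1; rewrite -Ny inE => /andP[].
have [pX|pD] := side p y0p; have [qX|qD] := side q y0q.
- exact: X1_clique.
- exact: X1D.
- by rewrite adj_sym; apply: X1D.
- exact: D_clique.
Qed.
End MixedModule.

Lemma minimal_module Z (a b c : G) : homogeneous Z -> a \in Z -> b \in Z -> a != b ->
  ~~ adj a b -> c \notin Z -> False.
Proof.
move=> hZ aZ bZ nab ab cZ.
have [/exists_inP[x xZ /exists_inP[y yZ xy]]|none] :=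
    boolP [exists x in Z, exists y in Z, adj x y].
  exact: (minimal_mixed_module hZ cZ xZ yZ xy aZ bZ nab ab).
apply: (minimal_stable_module hZ aZ bZ nab) => x y xZ yZ; apply: contra none => xy.
by apply/exists_inP; exists x => //; apply/exists_inP; exists y.
Qed.

(* By the preceding lemma a homogeneous set A is a clique.  Two vertices a, b of A are
   then adjacent twins, and the absence of kites makes N(a) a clique unless the vertices
   outside A with the same neighbours outside N(a) as some r in N(a) form a homogeneous
   set that is not a clique. *)
Lemma minimal_prime : prime_graph G.
Proof.
move=> A /andP[A1 AG].
have [/exists_inP[u uA /exists_inP[x xA /exists_inP[y yA /andP[ux uy]]]]|none] :=
    boolP [exists u in ~: A, exists x in A, exists y in A, adj u x && ~~ adj u y].
  by exists u; [rewrite inE in uA | exists x, y].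
have hA : homogeneous A.
  have half u x y : u \notin A -> x \in A -> y \in A -> adj u x -> adj u y.
    move=> uA xA yA ux; apply: contraNT none => uy.
    apply/exists_inP; exists u; first by rewrite inE.
    by apply/exists_inP; exists x => //; apply/exists_inP; exists y; rewrite ?ux.
  by move=> u x y uA xA yA; apply/idP/idP; apply: half.
have [c cA] : exists c, c \notin A.
  apply/existsP; apply: contraTT AG => /existsPn H; rewrite -leqNgt -cardsT subset_leq_card //.
  by apply/subsetP => x _; have := H x; rewrite negbK.
have [a aA] : exists a, a \in A by apply/set0Pn; rewrite -card_gt0 ltnW.
have [b bA nab] : exists2 b, b \in A & a != b.
  move: A1; rewrite (cardsD1 a) aA ltnS card_gt0 => /set0Pn[b]; rewrite !inE => /andP[nb bA].
  by exists b; rewrite // eq_sym.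
have A_clique x y : x \in A -> y \in A -> x != y -> adj x y.
  move=> xA yA nxy; apply: contraT => xy.
  by case: (minimal_module hA xA yA nxy xy cA).
have ab := A_clique a b aA bA nab.
have [/exists_inP[r ar /exists_inP[r' ar' /andP[nrr rr']]]|none'] :=
    boolP [exists r in adj a, exists r' in adj a, (r != r') && ~~ adj r r']; last first.
  case: (@minimal_not_nbrs_clique a); apply/cliqueP => x y; rewrite !inE => ax ay nxy.
  apply: contraNT none' => xy; apply/exists_inP; exists x => //.
  by apply/exists_inP; exists y; rewrite // nxy.
rewrite -!topredE /= in ar ar'.
have nbrA x y : adj a x -> adj a y -> x != y -> ~~ adj x y -> x \notin A.
  move=> ax ay nxy xy; apply: contra xy => xA; have [yA|yA] := boolP (y \in A).
    exact: A_clique.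
  by rewrite adj_sym (hA y x a) // adj_sym.
have nbrE x t : t \in A -> adj a x -> x \notin A -> adj x t.
  by move=> tA ax xA; rewrite (hA x t a) // adj_sym.
have same x y m : adj a x -> adj a y -> x != y -> ~~ adj x y -> m \notin A ->
    ~~ adj m a -> adj m x = adj m y.
  have half s s' : adj a s -> adj a s' -> s != s' -> ~~ adj s s' -> m \notin A ->
      ~~ adj m a -> adj m s -> adj m s'.
    move=> as1 as1' nss ss' mA ma ms; apply: contraT => ms'.
    have sA := nbrA s s' as1 as1' nss ss'.
    have s'A : s' \notin A by apply: (nbrA s' s); rewrite // 1?eq_sym // adj_sym.
    have := no_kite no_kite_G (p := a) (x := b) (w := s) (r := s') (u := m).
    rewrite (hA m b a) // (negPf ma) => H; apply: H => //.
    by rewrite ab as1 as1' (adj_sym b s) (adj_sym b s') (nbrE s) // (nbrE s').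
  move=> ax ay nxy xy mA ma; apply/idP/idP; apply: half => //; by rewrite 1?eq_sym // adj_sym.
pose R := [set x | [&& adj a x, x \notin A &
  [forall m, (m \notin A) && ~~ adj m a ==> (adj m x == adj m r)]]].
have RP x m : x \in R -> m \notin A -> ~~ adj m a -> adj m x = adj m r.
  rewrite inE => /and3P[_ _ /forallP/(_ m)/implyP H] mA ma.
  by apply/eqP/H; rewrite mA ma.
have Ra x : x \in R -> adj a x by rewrite inE => /andP[].
have RA x : x \in R -> x \notin A by rewrite inE => /and3P[].
have Rclosed x y : x \in R -> adj a y -> x != y -> ~~ adj x y -> y \in R.
  move=> xR ay nxy xy; have ax := Ra x xR.
  have yx : ~~ adj y x by rewrite adj_sym.
  have nyx : y != x by rewrite eq_sym.
  rewrite inE ay (nbrA y x) //; apply/forallP => m; apply/implyP => /andP[mA ma].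
  by rewrite -(RP x m) // (same y x).
have rR : r \in R.
  by rewrite inE ar (nbrA r r') //; apply/forallP => m; rewrite eqxx implybT.
have r'R : r' \in R by apply: Rclosed rR _ _ _.
(* A vertex outside R is complete to R if it lies in A or is adjacent to a, by [nbrE] and [Rclosed];
   otherwise the definition of R applies. *)
suff hR : homogeneous R.
  case: (@minimal_module R r r' a) => //; by apply/negP=> /RA; rewrite aA.
move=> u x y uR xR yR; have [uA|uA] := boolP (u \in A).
  rewrite (adj_sym u x) (adj_sym u y).
  by rewrite (nbrE x u uA (Ra x xR) (RA x xR)) (nbrE y u uA (Ra y yR) (RA y yR)).
have [ua|ua] := boolP (adj u a); last by rewrite (RP x) // (RP y).
have to s : s \in R -> adj u s.
  move=> sR; rewrite adj_sym; apply: contraNT (uR) => su.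
  apply: (Rclosed s u sR) => //; first by rewrite adj_sym.
  by apply: contraNneq uR => <-.
by rewrite (to x) // (to y).
Qed.

Lemma minimal_empty (v : G) : False.
Proof.
apply: (good_empty v); split=> //.
- exact: minimal_prime.
- exact: minimal_claw_diamond.
- exact: minimal_compl_claw_diamond.
Qed.
End Minimal.

(** * Induction on the number of vertices *)

Lemma occurs_induced (G : sgraph) (S : {set G}) p (ch : seq (induced S)) :
  occurs p ch -> occurs p [seq val u | u <- ch].
Proof.
elim: p ch => //= r p IH ch [u [uch <- /IH O]]; exists (val u); split=> //.
  by rewrite mem_map //; apply: val_inj.
by rewrite -map_comp.
Qed.

Lemma contains_induced (G : sgraph) (S : {set G}) p :
  contains (induced S) p -> contains G p.
Proof. by case=> x /occurs_induced O; exists (val x). Qed.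

Lemma colours_induced (G : sgraph) (S : {set G}) :
  colours [set: induced S] (2 * omega [set: induced S]) -> colours S (2 * omega S).
Proof.
case=> f [fS fP].
have le : omega [set: induced S] <= omega S.
  have [K /andP[/cliqueP cK _] <-] := omega_clique [set: induced S].
  rewrite -(card_imset (mem K) val_inj); apply: clique_omega.
    apply/cliqueP => _ _ /imsetP[x xK ->] /imsetP[y yK ->] nxy.
    by apply: (cK x y xK yK); apply: contraNneq nxy => ->.
  by apply/subsetP => _ /imsetP[x _ ->]; apply: valP.
pose g x := if insub x is Some u then f (u : induced S) else 0.
have gE x (xS : x \in S) : g x = f (Sub x xS) by rewrite /g insubT.
exists g; split=> [x xS|x y xS yS xy]; rewrite !gE.
  by apply: leq_trans (fS _ (in_setT _)) _; rewrite leq_mul2l le.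
exact: fP.
Qed.

Lemma colours_omega (G : sgraph) :
  ~ contains G fork_pat -> ~ contains G (neg fork_pat) ->
  colours [set: G] (2 * omega [set: G]).
Proof.
have [n] := ubnP #|G|; elim: n G => // n IH G Gn nf nk.
have [/colorableP //|/negP nc] := boolP (colorable G (2 * omega [set: G])).
(* [minimal_empty] needs a vertex, so the graph without vertices is coloured directly. *)
have [v _|G0] := pickP (mem [set: G]); last first.
  by exists (fun=> 0); split=> x; have := G0 x; rewrite /= inE.
case: (@minimal_empty G nf nk _ _ v) => [S ST|/colorableP //].
apply/colours_induced/IH; try by move/contains_induced.
rewrite card_sig; apply: leq_trans (_ : #|G| <= n); last by rewrite -ltnS.
by rewrite -cardsT; apply: proper_card; rewrite properT.
Qed.

Theorem mainTheorem2 (G : sgraph) :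
  uncluttered G -> chromatic_number G <= 2 * clique_number G.
Proof.
case/uncluttered_contains => nf nk; rewrite clique_numberE.
exact/chromatic_number_le/colours_omega.
Qed.
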